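(* (i) For all integers $m,n\ge0$, \[ T_{n,m}\le C_n I_{n,m}\le C_n\binom{n+m-1}{n-1}. \] (ii) If $n\to\infty$ and $m=m(n)=o(n^{3/2})$, then \[ \exp\Bigl[-2\,\frac{m}{n}\log n\Bigr]\,C_n\binom{n+m-1}{n-1}=O(T_{n,m}), \] i.e. there is a constant $c>0$ such that $T_{n,m}\ge c\,\exp[-2(m/n)\log n]\,C_n\binom{n+m-1}{n-1}$ for all sufficiently large $n$.
   Context: A chord diagram with $n$ chords is a pairing of the $2n$ points labeled $1,\dots,2n$; the chords $\{a,b\}$, $\{c,d\}$ with $a<b$, $c<d$ cross if $a<c<b<d$ or $c<a<d<b$. $T_{n,m}$ is the number of chord diagrams with $n$ chords and exactly $m$ crossing pairs of chords ($T_{0,0}=1$, $T_{0,m}=0$ for $m>0$). $C_n=\frac1{n+1}\binom{2n}{n}$ is the $n$-th Catalan number. $I_{n,m}$ is the number of permutations of $\{1,\dots,n\}$ with exactly $m$ inversions ($I_{0,0}=1$, $I_{0,m}=0$ for $m>0$). The number $\binom{n+m-1}{n-1}$ is the number of solutions of $x_1+\dots+x_n=m$ in non-negative integers; for $n=0$ it is interpreted as $1$ if $m=0$ and $0$ if $m>0$. In (ii), $m=m(n)$ is a sequence of non-negative integers. *)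

(* Defs.v *)
From mathcomp Require Import all_boot all_fingroup.

Set Implicit Arguments.
Unset Strict Implicit.
Unset Printing Implicit Defensive.

(* The points 1, ..., 2n are represented by the ordinals 0, ..., 2n - 1, and a
   chord by the two-element set of its endpoints. *)
Definition chord_diagram (n : nat) (D : {set {set 'I_(2 * n)}}) : bool :=
  partition D [set: 'I_(2 * n)] && [forall A in D, #|A| == 2].

Definition cross (N : nat) (A B : {set 'I_N}) : bool :=
  [exists a : 'I_N, exists b : 'I_N, exists c : 'I_N, exists d : 'I_N,
    [&& A == [set a; b], a < b, B == [set c; d], c < d
      & [&& a < c, c < b & b < d] || [&& c < a, a < d & d < b]]].

(* Crossings are counted as unordered pairs [set A; B] of chords. *)
Definition crossings (N : nat) (D : {set {set 'I_N}}) : nat :=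
  #|[set [set A; B] | A in D, B in D & cross A B]|.

Definition nb_diagrams (n m : nat) : nat :=
  #|[set D : {set {set 'I_(2 * n)}} | chord_diagram D & crossings D == m]|.

(* The division is exact. *)
Definition catalan (n : nat) : nat := 'C(2 * n, n) %/ n.+1.

Definition inversions (n : nat) (s : 'S_n) : nat :=
  #|[set p : 'I_n * 'I_n | p.1 < p.2 & s p.2 < s p.1]|.

Definition nb_perms (n m : nat) : nat := #|[set s : 'S_n | inversions s == m]|.

(* Truncated subtraction would give 1 for n = 0 and every m, whereas the number
   of solutions of the empty equation 0 = m is 1 only for m = 0. *)
Definition weak_compositions (n m : nat) : nat :=
  if n == 0 then (m == 0 : nat) else 'C(n + m - 1, n - 1).

(* Main.v *)
Require Import Defs.
From mathcomp Require Import all_boot all_fingroup all_order all_algebra.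
From mathcomp Require Import zify ring lra.

(** Read a chord diagram from left to right.  When [h] chords are open, a point
    either opens a new chord or closes one of the [h] open ones, and closing a
    chord makes it cross exactly the open chords that started after it: these
    are [0], [1], ..., or [h - 1] in number, according to the choice.  Diagrams
    with [m] crossings therefore correspond to Dyck paths in which every down
    step, from height [h] say, carries a label below [h], the labels having sum
    [m]: the generating polynomial of the diagrams by crossings is the sum over
    Dyck paths of the product of the [qint h] over the down steps, where
    [qint h] is [1 + q + ... + q^(h-1)] ([nb_diagrams_wpaths]).

    Upper bounds.  Permutations by inversions have the generating polynomial
    [qint 1 * ... * qint n] ([nb_perms_coef]).  The [n] heights of a Dyck path,
    suitably ordered, are at most [1, ..., n], hence each path contributes at
    most this product, coefficient by coefficient, and there are [catalan n]
    paths ([nb_diagrams_le]).  Dropping the bounds on the labels altogether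
    leaves the weak compositions of [m] ([nb_perms_le]).

    Lower bound.  Keep only the paths made of [L] up steps, a Dyck path [P], and
    [L] down steps.  A label of [P] then has a bound above [L].  Put
    [r = 1 - 1/s] with [s] slightly larger than [m/n].  Among the weak
    compositions of [m], those in which a given unknown is at least [J] are a
    fraction at most [r^J] ([compositions_ge_le_ratio]); and on average a Dyck
    path has at most [2 * h + 1] down steps at height [h], since cutting the
    path at such a step and reversing the rest yields a path that ends at height
    [2 * h] ([marked0], [walks_even_le]).  The expected number of violated
    bounds is therefore at most [2 * s^2 * r^L], and this is at most [1/2] once
    [L] is about [2 * s * ln s]: half of the pairs of a path [P] and a
    composition survive ([wpaths_lifted_ge]).  The labels of the final descent,
    bounded by [L], ..., [1], cost a factor [(1 - r) * ... * (1 - r^L)], which is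
    at least [1 / 'C(L + s, s)] ([prod_ratio_ge]), hence at least
    [4^L / 5^(L + s)].  As [catalan (n - L)] is at least [catalan n / 4^L], the
    total loss is at most [2 * 5^(L + s)] ([nb_diagrams_lower]).

    Now take [s] close to [1.1 * m/n].  If [m = o(n^(3/2))], then [s] is at most
    the square root of [n], so [2 * ln s <= ln n], and [L + s] is at most
    [1.1 * (m/n) * ln n] up to terms of order [m/n] and [1].  Since
    [1.1 * ln 5 < 2], the factor [exp (- 2 * (m/n) * ln n)] absorbs the loss up
    to a constant ([nb_diagrams_ge_exp]). *)

Set Implicit Arguments.
Unset Strict Implicit.
Unset Printing Implicit Defensive.
Import GRing.Theory.
Local Open Scope ring_scope.

(** * Labelled Dyck paths and codes of diagrams *)

Definition qint (h : nat) : {poly nat} := \sum_(x < h) 'X^x.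

(** The sum, over the walks of [k] steps from height 0 to height [h] that stay
    nonnegative, of the product of the [qint (L + i)] over the down steps, [i]
    being the height at which the step starts.  The shift [L] serves for paths
    that stay above height [L]. *)
Fixpoint wpaths (L k h : nat) : {poly nat} :=
  if k is k'.+1 then
    (if h is h'.+1 then wpaths L k' h' else 0)
      + qint (L + h.+1) * wpaths L k' h.+1
  else (h == 0%N)%:R.

Section Codes.
Local Open Scope nat_scope.

(** A diagram cut after its first [k] points is encoded by the list, from the
    last point to the first, of the left endpoint of the chord of each point; a
    point that opens a chord encodes itself.  The most recent point comes first,
    so that adding a point is a [cons] and the open chords are found by
    structural recursion, in decreasing order. *)
Fixpoint opens (s : seq nat) : seq nat :=
  if s is c :: s' then
    if c == size s' then c :: opens s' else rem c (opens s')
  else [::].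

Fixpoint legal (s : seq nat) : bool :=
  if s is c :: s' then legal s' && ((c == size s') || (c \in opens s'))
  else true.

(** Closing the chord that starts at [c] makes it cross the chords that started
    after [c] and are still open; every crossing is seen once, at the end of the
    chord that closes first. *)
Fixpoint ncross (s : seq nat) : nat :=
  if s is c :: s' then ncross s' + count (ltn c) (opens s') else 0.

Fixpoint codes (k : nat) : seq (seq nat) :=
  if k is k'.+1 then
    [seq c :: s | s <- codes k', c <- size s :: opens s]
  else [:: [::]].

Lemma opens_lt s : legal s -> {in opens s, forall c, c < size s}.
Proof.
elim: s => //= c s IHs /andP[/IHs{}IHs _] x.
case: eqP => [->|_]; last by move/mem_rem/IHs/ltnW.
by rewrite inE => /predU1P[->|/IHs/ltnW].
Qed.

Lemma opens_sorted s : legal s -> sorted gtn (opens s).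
Proof.
elim: s => //= c s IHs /andP[ls _].
case: eqP => [->|_] /=.
  rewrite path_min_sorted ?IHs //; apply/allP => x.
  exact: opens_lt.
apply: subseq_sorted (rem_subseq _ _) (IHs ls).
by move=> x y z /= yx zx; apply: ltn_trans zx yx.
Qed.

Lemma opens_uniq s : legal s -> uniq (opens s).
Proof.
move=> /opens_sorted; apply: sorted_uniq => [x y z /= yx xz|x /=]; last by rewrite ltnn.
exact: ltn_trans xz yx.
Qed.

Lemma mem_codes k s : (s \in codes k) = legal s && (size s == k).
Proof.
elim: k s => [|k IHk] s; first by case: s => [|c s] //=; rewrite andbF.
apply/allpairsPdep/idP => [[s' [c [+ + ->]]]|].
  rewrite IHk => /andP[ls' /eqP ss']; rewrite inE => hc /=.
  by rewrite ls' ss' eqxx andbT -ss'.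
case: s => // c s /= /andP[/andP[ls hc] ss].
by exists s, c; rewrite IHk ls inE hc.
Qed.

Lemma codes_uniq k : uniq (codes k).
Proof.
elim: k => // k IHk /=.
apply: (@allpairs_uniq_dep _ (fun=> nat) _ (fun s c => c :: s) (codes k)
  (fun s => size s :: opens s)) => //.
  move=> s; rewrite mem_codes => /andP[ls _] /=; rewrite opens_uniq // andbT.
  by apply/negP => /opens_lt; rewrite ltnn => /(_ ls).
by move=> [s c] [s' c'] _ _ /= [-> ->].
Qed.

(** Whichever set of chords is open, the numbers of crossings created by the
    possible closings are [0], [1], ..., each once; this is where [qint] comes
    from. *)
Lemma count_above_iota (o : seq nat) : sorted gtn o ->
  [seq count (ltn c) o | c <- o] = iota 0 (size o).
Proof.
elim: o => //= a o IHo ao.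
have /allP lt_a: all (gtn a) o.
  by apply: order_path_min ao => x y z /= yx xz; apply: ltn_trans xz yx.
rewrite /= ltnn (_ : count _ _ = 0); last first.
  apply/eqP; rewrite -leqn0 leqNgt -has_count; apply/hasPn => x.
  by move=> /lt_a /= /ltnW; rewrite leqNgt.
rewrite addn0 (iotaDl 1 0) -IHo ?(path_sorted ao) // -map_comp; congr (_ :: _).
by apply/eq_in_map => x /lt_a /= ->; rewrite add1n.
Qed.

End Codes.

(** The height of the walk is the number of open chords. *)
Lemma codes_wpaths k h :
  \sum_(s <- codes k | size (opens s) == h) 'X^(ncross s) = wpaths 0 k h.
Proof.
elim: k h => [|k IHk] h.
  by rewrite big_cons big_nil /= [h == _]eq_sym; case: eqP => _; rewrite ?addr0.
rewrite big_mkcond big_allpairs_dep /=.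
transitivity (\sum_(s <- codes k) ((if (size (opens s)).+1 == h then 'X^(ncross s) else 0)
   + (if size (opens s) == h.+1 then qint h.+1 * 'X^(ncross s) else 0)) : {poly nat}).
  apply: eq_big_seq => s; rewrite mem_codes => /andP[ls _].
  rewrite big_cons eqxx /=; congr (_ + _).
    rewrite (_ : count _ _ = 0%N) ?addn0 //.
    apply/eqP; rewrite -leqn0 leqNgt -has_count; apply/hasPn => x.
    by move=> /(opens_lt ls) /= /ltnW; rewrite leqNgt.
  transitivity (\sum_(x <- [seq count (ltn c) (opens s) | c <- opens s])
     (if size (opens s) == h.+1 then 'X^(ncross s + x) else 0 : {poly nat})).
    rewrite big_map; apply: eq_big_seq => c hc.
    rewrite (ltn_eqF (opens_lt ls hc)).
    by rewrite size_rem //; move: hc; case: (opens s).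
  rewrite count_above_iota ?opens_sorted //.
  case: eqP => [->|_]; last by rewrite big1.
  rewrite /qint mulr_suml -(big_mkord xpredT (fun x => 'X^x * 'X^(ncross s))) /index_iota subn0.
  by apply: eq_bigr => x _; rewrite exprD mulrC.
rewrite big_split /= -!big_mkcond -!big_distrr /= IHk; congr (_ + _).
case: h => [|h]; first by rewrite big_pred0.
by rewrite -IHk.
Qed.

(** * Diagrams and their codes *)

Section Diagrams.
Local Open Scope nat_scope.

Fixpoint code (f : nat -> nat) (k : nat) : seq nat :=
  if k is k'.+1 then f k' :: code f k' else [::].

Lemma size_code f k : size (code f k) = k.
Proof. by elim: k => //= k ->. Qed.

Lemma nth_rev_code f k i : i < k -> nth 0 (rev (code f k)) i = f i.
Proof.
elim: k => //= k IHk; rewrite rev_cons nth_rcons size_rev size_code ltnS leq_eqVlt.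
by case/predU1P=> [->|ik]; [rewrite ltnn eqxx | rewrite ik IHk].
Qed.

Lemma eq_code f g k : (forall i, i < k -> f i = g i) -> code f k = code g k.
Proof.
elim: k => //= k IHk fg; rewrite fg // IHk // => i ik.
by apply/fg/ltnW.
Qed.

Lemma code_rev s : code (nth 0 (rev s)) (size s) = s.
Proof.
elim: s => //= c s IHs; rewrite rev_cons nth_rcons size_rev ltnn eqxx; congr (_ :: _).
by rewrite -[RHS]IHs; apply: eq_code => i it; rewrite nth_rcons size_rev it.
Qed.

(** [f] plays the role of the function that sends a point to the left endpoint of
    its chord. *)
Definition still_open (f : nat -> nat) (k i : nat) : bool :=
  (f i == i) && ~~ has (fun l => (i < l) && (f l == i)) (iota 0 k).

Lemma still_openP f k i :
  reflect (f i = i /\ forall l, i < l -> l < k -> f l <> i) (still_open f k i).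
Proof.
apply: (iffP andP) => [[/eqP fi /hasPn no]|[fi no]].
  split=> // l il lk /eqP fl.
  by have := no l; rewrite mem_iota add0n lk il fl => /(_ isT).
split; first exact/eqP.
apply/hasPn => l; rewrite mem_iota add0n => /= lk; apply/negP => /andP[il /eqP].
exact: no.
Qed.

Lemma rev_iotaS k : rev (iota 0 k.+1) = k :: rev (iota 0 k).
Proof. by rewrite -addn1 iotaD rev_cat. Qed.

Lemma opens_code f k : legal (code f k) ->
  opens (code f k) = [seq i <- rev (iota 0 k) | still_open f k i].
Proof.
elim: k => // k IHk /= /andP[lk hk]; rewrite size_code rev_iotaS /=.
have openS i : i < k -> still_open f k.+1 i = still_open f k i && (f k != i).
  move=> ik; rewrite /still_open -[k.+1]addn1 iotaD has_cat /= add0n ik orbF negb_or.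
  by rewrite andbA.
case: eqP => fk.
  have -> : still_open f k.+1 k.
    by apply/still_openP; split=> // l; rewrite ltnS => kl; rewrite leqNgt kl.
  rewrite fk IHk //; congr (_ :: _); apply: eq_in_filter => i.
  rewrite mem_rev mem_iota add0n => /= ik.
  by rewrite openS // fk (gtn_eqF ik) andbT.
have -> : still_open f k.+1 k = false by apply/still_openP => -[].
rewrite rem_filter ?opens_uniq // IHk // -filter_predI; apply: eq_in_filter => i.
by rewrite mem_rev mem_iota add0n => /= ik; rewrite openS // eq_sym andbC.
Qed.

Lemma mem_opens_code f k i : legal (code f k) ->
  (i \in opens (code f k)) = (i < k) && still_open f k i.
Proof.
by move=> lk; rewrite opens_code // mem_filter mem_rev mem_iota andbC add0n.
Qed.

Lemma legal_code_prefix f N j : j <= N -> legal (code f N) -> legal (code f j).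
Proof. by move/subnK <-; elim: (N - j) => //= d IHd /andP[/IHd]. Qed.

(** The third condition bounds the fibers of [f]: three points with the same image
    would give two distinct fixed points with the same image. *)
Definition pairing (N : nat) (f : nat -> nat) :=
  [/\ forall i, i < N -> f i <= i,
      forall i, i < N -> f (f i) = f i,
      forall i j, i < j -> j < N -> f i = f j -> f i = i
    & forall i, i < N -> f i = i -> exists2 j, i < j < N & f j = i].

Lemma pairing_code N f :
  pairing N f <-> legal (code f N) /\ opens (code f N) = [::].
Proof.
split=> [[f_le ff f_inj f_surj]|[lN oN]].
  have lN : legal (code f N).
    have: N <= N by []; elim: {1 3}N => //= k IHk kN.
    have lk := IHk (ltnW kN); rewrite lk size_code mem_opens_code //=.
    have := f_le k kN; rewrite leq_eqVlt => /orP[->//|fk].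
    rewrite fk orbC /=; apply/orP; left; apply/still_openP; split; first exact: ff.
    by move=> l kl lk' fl; have := f_inj l k lk' kN fl; rewrite fl; lia.
  split=> //; rewrite opens_code //; apply/eqP; rewrite -(negbK (_ == _)) -has_filter.
  apply/hasPn => i; rewrite mem_rev mem_iota add0n => /= iN.
  apply/still_openP => -[fi no].
  by have [j /andP[ij jN]] := f_surj i iN fi; apply: no.
have legal_step j : j < N -> legal (code f j) /\
    (f j = j \/ f j < j /\ still_open f j (f j)).
  elim: {oN} N lN j => //= k IHk /andP[lk].
  rewrite size_code mem_opens_code // => hk j; rewrite ltnS leq_eqVlt.
  case/predU1P => [->|]; last exact: IHk.
  by split=> //; case/orP: hk => [/eqP|/andP]; [left|right].
have f_le i : i < N -> f i <= i.
  by move=> /legal_step[_ [->//|[/ltnW]]].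
split=> // [i iN|i j ij jN fij|i iN fi].
- by have [_ [fi|[_ /still_openP[]]]] := legal_step i iN; rewrite ?fi.
- have := f_le i (ltn_trans ij jN).
  have [_ [fj|[_ /still_openP[fj no]]]] := legal_step j jN; first by lia.
  rewrite leq_eqVlt => /predU1P[//|fi].
  by case: (no i _ _ fij) => //; rewrite -fij.
- have : i \notin opens (code f N) by rewrite oN.
  rewrite mem_opens_code // iN /= /still_open fi eqxx negbK => /hasP[l].
  by rewrite mem_iota add0n => /= lN' /andP[il /eqP fl]; exists l => //; rewrite il.
Qed.

(** A crossing is recorded by the two middle ones of its four endpoints: the start
    of the later chord and the end of the earlier one. *)
Definition interleaved (N : nat) (f : nat -> nat) : {set 'I_N * 'I_N} :=
  [set p : 'I_N * 'I_N | [&& p.1 < p.2, f p.2 < p.1 & still_open f p.2 p.1]].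

Lemma ncross_code N f : pairing N f ->
  ncross (code f N) = #|interleaved N f|.
Proof.
move=> /pairing_code[lN _].
have legalj j (jN : j <= N) := legal_code_prefix jN lN.
transitivity (\sum_(j < N) \sum_(i < N | [&& i < j, f j < i & still_open f j i]) 1).
  suff ncrossE k : k <= N -> ncross (code f k) = \sum_(0 <= j < k)
      \sum_(i < N | [&& i < j, f j < i & still_open f j i]) 1.
    by rewrite ncrossE // big_mkord.
  elim: k => [|k IHk] kN; first by rewrite big_geq.
  rewrite big_nat_recr //= (IHk (ltnW kN)); congr (_ + _).
  rewrite opens_code; last exact: (legalj _ (ltnW kN)).
  rewrite count_filter -[LHS]sum1_count.
  rewrite (perm_big (index_iota 0 k)) /=; last by rewrite /index_iota subn0 perm_rev.
  rewrite big_mkord.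
  rewrite (big_ord_widen_cond N (fun i => (f k < i) && still_open f k i) (fun=> 1) (ltnW kN)).
  by apply: eq_bigl => i; rewrite andbC.
by rewrite (exchange_big_dep xpredT) //= pair_big_dep /= sum1dep_card.
Qed.

Definition fibers (N : nat) (f : nat -> nat) : {set {set 'I_N}} :=
  preim_partition (fun x : 'I_N => f x) [set: 'I_N].

Definition fiber (N : nat) (f : nat -> nat) (x : 'I_N) : {set 'I_N} :=
  [set y : 'I_N | f y == f x].

Lemma fibersE N f : fibers N f = [set fiber f x | x : 'I_N].
Proof.
apply/setP => A; apply/imsetP/imsetP => -[x _ ->]; exists x => //;
by apply/setP => y; rewrite !inE eq_sym.
Qed.

Lemma fiber_eq N f (x y : 'I_N) : (fiber f x == fiber f y) = (f x == f y).
Proof.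
apply/eqP/eqP => [/setP/(_ x)|fxy]; first by rewrite !inE eqxx => /esym/eqP.
by apply/setP => z; rewrite !inE fxy.
Qed.

Lemma fiber_pairing N f (x : 'I_N) : pairing N f ->
  exists a b : 'I_N, [/\ a < b, f a = a :> nat, f b = a :> nat,
    fiber f x = [set a; b] & f x = a].
Proof.
case=> f_le ff f_inj f_surj; have xN := ltn_ord x.
have aN : f x < N by apply: leq_ltn_trans (f_le x xN) xN.
have [b /andP[ab bN] fb] := f_surj _ aN (ff x xN).
exists (Ordinal aN), (Ordinal bN); split; rewrite /= ?ff //.
apply/setP => y; rewrite !inE -!val_eqE /=.
apply/eqP/orP => [fy|[/eqP ->|/eqP ->]]; rewrite ?ff //.
have yN := ltn_ord y.
have := ltngtP (val y) b; case=> [yb|yb|->]; last by right.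
- by left; rewrite -fy; have := f_inj y b yb bN; rewrite fb fy => <-.
- by have := f_inj b y yb yN; rewrite fb fy => /(_ erefl) eb; lia.
Qed.

Lemma fibers_diagram n f : pairing (2 * n) f -> chord_diagram (fibers (2 * n) f).
Proof.
move=> pf; apply/andP; split; first exact: preim_partitionP.
apply/forall_inP => A; rewrite fibersE => /imsetP[x _ ->].
have [a [b [ab _ _ -> _]]] := fiber_pairing x pf.
by rewrite cards2 -val_eqE (ltn_eqF ab).
Qed.

(** On each block, a pairing is the smallest point of the block, so it can be
    recovered from the partition. *)
Lemma fibers_inj N f g : pairing N f -> pairing N g ->
  fibers N f = fibers N g -> forall i, i < N -> f i = g i.
Proof.
move=> pf pg efg.
have same (x y : 'I_N) : (f x == f y) = (g x == g y).
  rewrite -!fiber_eq.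
  have fib (h : nat -> nat) (z : 'I_N) : fiber h z = pblock (fibers N h) z.
    have /and3P[_ ti _] := preim_partitionP (fun u : 'I_N => h u) [set: 'I_N].
    apply/esym/def_pblock => //; last by rewrite inE.
    by rewrite -/(fibers N h) fibersE imset_f.
  by rewrite !fib efg.
(* h1 i lies in the block of i, so h2 i = h2 (h1 i) <= h1 i *)
have le h1 h2 : pairing N h1 -> pairing N h2 ->
    (forall x y : 'I_N, (h1 x == h1 y) = (h2 x == h2 y)) ->
    forall i, i < N -> h2 i <= h1 i.
  move=> [h1_le hh1 _ _] [h2_le hh2 _ _] e i iN.
  have h1N : h1 i < N by apply: leq_ltn_trans (h1_le i iN) iN.
  have := e (Ordinal h1N) (Ordinal iN); rewrite /= hh1 // eqxx => /esym/eqP <-.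
  exact: h2_le.
by move=> i iN; apply/eqP; rewrite eqn_leq (le g f) // (le f g).
Qed.

Lemma diagram_fibers n (D : {set {set 'I_(2 * n)}}) : chord_diagram D ->
  exists2 f, pairing (2 * n) f & D = fibers (2 * n) f.
Proof.
move=> /andP[partD /forall_inP card2].
have /and3P[/eqP covD tiD n0D] := partD.
have mem_pb x : x \in pblock D x by rewrite mem_pblock covD inE.
have pbD x : pblock D x \in D by rewrite pblock_mem // covD inE.
(* F x is the left endpoint of the chord of x *)
pose F (x : 'I_(2 * n)) := [arg min_(y < x in pblock D x) val y].
have F_pb x : pblock D (F x) = pblock D x.
  by apply: same_pblock => //; rewrite /F; case: arg_minnP.
have F_min x y : y \in pblock D x -> F x <= y.
  by rewrite /F; case: arg_minnP => //= i _; apply.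
have F_in x : F x \in pblock D x by rewrite -F_pb.
have F_eq x y : (F x == F y) = (pblock D x == pblock D y).
  apply/eqP/eqP => [e|e]; first by rewrite -F_pb e F_pb.
  have le u v : pblock D u = pblock D v -> F u <= F v by move=> uv; rewrite F_min // uv.
  by apply/val_inj/eqP; rewrite /= eqn_leq !le.
pose f i := if insub i is Some x then val (F x) else i.
have fE (x : 'I_(2 * n)) : f x = F x by rewrite /f valK.
exists f; last first.
  rewrite -(preim_partition_pblock partD); apply/setP => A.
  by apply/imsetP/imsetP => -[x _ ->]; exists x => //; apply/setP => y;
    rewrite !inE !fE val_eqE F_eq.
split.
- by move=> i iN; rewrite -[i]/(val (Ordinal iN)) fE F_min.
- move=> i iN; rewrite -[i]/(val (Ordinal iN)) !fE.
  by apply/eqP; rewrite val_eqE F_eq F_pb.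
- move=> i j ij jN; have iN := ltn_trans ij jN.
  pose x := Ordinal iN; pose y := Ordinal jN.
  rewrite -[i]/(val x) -[j]/(val y) !fE => /val_inj/eqP; rewrite F_eq => /eqP exy.
  have Fx_x : F x <= x := F_min _ _ (mem_pb x).
  have y_x : y \in pblock D x by rewrite exy.
  have /cards2P[a [b [_ pbx]]] := card2 _ (pbD x).
  move: (F_in x) (mem_pb x) y_x; rewrite pbx !inE => Fab xab yab.
  have xy : val x < val y by [].
  clear -Fx_x xy Fab xab yab; rewrite -!val_eqE /= in Fab xab yab xy Fx_x *.
  by move: (val (F x)) Fx_x Fab => u; lia.
- move=> i iN; pose x := Ordinal iN; rewrite -[i]/(val x) fE => /val_inj Fx.
  have /cards2P[a [b [ab pbx]]] := card2 _ (pbD x).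
  have [y yx yDx] : exists2 y, y != x & y \in pblock D x.
    have := mem_pb x; rewrite pbx !inE => /orP[] /eqP xE.
      by exists b; rewrite ?inE ?eqxx ?orbT // xE eq_sym.
    by exists a; rewrite ?inE ?eqxx // xE.
  exists y.
    rewrite ltn_ord andbT ltn_neqAle val_eqE eq_sym yx.
    by rewrite -{1}Fx F_min.
  by rewrite fE -Fx; congr val; apply/eqP; rewrite F_eq; apply/eqP/same_pblock.
Qed.

Lemma fiber_endpoints N f (x a b : 'I_N) : pairing N f ->
  fiber f x = [set a; b] -> a < b -> [/\ f a = a :> nat, f b = a :> nat & f x = a].
Proof.
move=> [_ _ f_inj _] fxE ab.
have : a \in fiber f x by rewrite fxE !inE eqxx.
have : b \in fiber f x by rewrite fxE !inE eqxx orbT.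
rewrite !inE => /eqP fb /eqP fa.
by have := f_inj a b ab (ltn_ord b); rewrite fa fb => ->.
Qed.

(** The chord that starts at [c] is still open at [b] because its only other point
    is [d], beyond [b]. *)
Lemma cross_interleaved N f (x y a b c d : 'I_N) : pairing N f ->
  fiber f x = [set a; b] -> fiber f y = [set c; d] -> a < c -> c < b -> b < d ->
  (c, b) \in interleaved N f /\ [set fiber f c; fiber f b] = [set fiber f x; fiber f y].
Proof.
move=> pf fxE fyE ac cb bd.
have [fa fb fx] := fiber_endpoints pf fxE (ltn_trans ac cb).
have [fc fd fy] := fiber_endpoints pf fyE (ltn_trans cb bd).
split.
  rewrite inE /= cb fb ac; apply/still_openP; split=> // l cl lb fl.
  have lN := ltn_trans lb (ltn_ord b).
  have : Ordinal lN \in fiber f y by rewrite inE /= fl fy.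
  by rewrite fyE !inE -!val_eqE /=; lia.
rewrite setUC; congr [set _; _]; apply/eqP; rewrite fiber_eq.
  by rewrite fb fx.
by rewrite fc fy.
Qed.

Lemma interleaved_cross N f (p : 'I_N * 'I_N) : pairing N f ->
  p \in interleaved N f -> cross (fiber f p.1) (fiber f p.2).
Proof.
case: p => c b pf; rewrite inE => /= /and3P[cb fb_c /still_openP[fc no]].
have [c' [d [cd _ fd fcE]]] := fiber_pairing c pf; rewrite fc => /val_inj ec.
have [a [b' [ab fa fb' fbE fb]]] := fiber_pairing b pf.
have eb : b = b'.
  have : b \in fiber f b by rewrite inE.
  rewrite fbE !inE => /orP[] /eqP // ba.
  by move: fb_c; rewrite ba fa -ba ltnNge ltnW.
rewrite -ec -eb in cd fd fcE ab fb' fbE *.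
apply/existsP; exists c; apply/existsP; exists d.
apply/existsP; exists a; apply/existsP; exists b.
rewrite -fcE -fbE !eqxx cd ab -[val a]fb /= fb_c cb orbC /=.
rewrite ltnNge leq_eqVlt; apply/orP; left; apply/negP => /orP[/eqP/val_inj db|db].
  by move: fb_c; rewrite -db fd ltnn.
exact: (no d).
Qed.

Lemma fibers_crossings N f : pairing N f -> crossings (fibers N f) = ncross (code f N).
Proof.
move=> pf; rewrite ncross_code //.
pose chords (p : 'I_N * 'I_N) := [set fiber f p.1; fiber f p.2].
have [_ _ f_inj _] := pf.
have chords_inj : {in interleaved N f &, injective chords}.
  move=> [c b] [c' b'] + + e; rewrite !inE => /= /and3P[cb fb /andP[/eqP fc _]].
  move=> /and3P[cb' fb' /andP[/eqP fc' _]].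
  have : fiber f c \in chords (c', b') by rewrite -e !inE eqxx.
  have : fiber f b \in chords (c', b') by rewrite -e !inE eqxx orbT.
  have : fiber f c' \in chords (c, b) by rewrite e !inE eqxx.
  rewrite !inE !fiber_eq !fc !fc' /= => h1 h2 h3.
  have ec : c = c' by apply: val_inj => /=; lia.
  have ef : f b = f b' by rewrite -ec in h2 *; lia.
  rewrite ec; congr (_, _); apply: val_inj => /=; have := f_inj b b'; have := f_inj b' b.
  by have := ltn_ord b; have := ltn_ord b'; lia.
rewrite -(card_in_imset chords_inj); congr #|pred_of_set _|.
apply/setP => E; apply/imset2P/imsetP => [[A B]|[p pZ ->]]; last first.
  exists (fiber f p.1) (fiber f p.2) => //; rewrite ?inE fibersE imset_f //=.
  exact: interleaved_cross.
rewrite inE fibersE => /imsetP[x _ ->] /andP[/imsetP[y _ ->]].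
move=> /existsP[a /existsP[b /existsP[c /existsP[d /and5P[/eqP xE ab /eqP yE cd]]]]] xy ->.
case/orP: xy => /and3P[h1 h2 h3].
  by have [? <-] := cross_interleaved pf xE yE h1 h2 h3; exists (c, b).
by have [? e] := cross_interleaved pf yE xE h1 h2 h3; exists (a, d) => //; rewrite setUC -e.
Qed.

Lemma nb_diagrams_codes n m : nb_diagrams n m =
  count (fun s => (size (opens s) == 0) && (ncross s == m)) (codes (2 * n)).
Proof.
set N := 2 * n; pose D s : {set {set 'I_N}} := fibers N (nth 0 (rev s)).
set P := fun s => _.
have Ppair s : s \in filter P (codes N) ->
    [/\ size s = N, ncross s = m & pairing N (nth 0 (rev s))].
  rewrite mem_filter mem_codes => /andP[/andP[/nilP o0 /eqP xm] /andP[ls /eqP sN]].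
  by split=> //; apply/pairing_code; rewrite -sN code_rev.
rewrite -size_filter -(size_map D).
have <- : #|map D (filter P (codes N))| = size (map D (filter P (codes N))).
  apply/card_uniqP; rewrite map_inj_in_uniq ?filter_uniq ?codes_uniq //.
  move=> s t /Ppair[sN _ ps] /Ppair[tN _ pt] /(fibers_inj ps pt) est.
  by rewrite -[s]code_rev -[t]code_rev sN tN; apply: eq_code.
apply: eq_card => E; rewrite inE; apply/andP/mapP => [[cE /eqP xE]|[s /Ppair[sN xs ps] ->]].
  have [f pf EE] := diagram_fibers cE; have [lf of0] := iffLR (pairing_code _ _) pf.
  exists (code f N).
    by rewrite mem_filter mem_codes lf size_code eqxx /P of0 -xE EE fibers_crossings ?eqxx.
  rewrite EE; apply/setP => A.
  apply/imsetP/imsetP => -[x _ ->]; exists x => //; apply/setP => y;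
    by rewrite !inE !nth_rev_code.
by rewrite fibers_diagram // fibers_crossings // -[2 * n]/N -sN code_rev xs.
Qed.

Lemma nb_diagrams_wpaths n m : nb_diagrams n m = ((wpaths 0 (2 * n) 0)`_m)%R.
Proof.
rewrite nb_diagrams_codes -codes_wpaths coef_sum -sum1_count big_mkcondr.
by apply: eq_bigr => s _; rewrite coefXn eq_sym; case: eqP.
Qed.

End Diagrams.

(** * Permutations by inversions *)

(** The image [j] of the first point is inverted with the [j] smaller values, and
    the other points are ordered as by [s]. *)
Lemma inversions_lift n (j : 'I_n.+1) (s : 'S_n) :
  inversions (lift_perm ord0 j s) = (j + inversions s)%N.
Proof.
set t := lift_perm ord0 j s.
have t0 : t ord0 = j by rewrite lift_perm_id.
have tl i : t (lift ord0 i) = lift j (s i) by rewrite lift_perm_lift.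
pose A := [set (ord0 : 'I_n.+1, i) | i : 'I_n.+1 & (t i < j)%N].
pose B := [set (lift ord0 p.1 : 'I_n.+1, lift ord0 p.2 : 'I_n.+1) |
             p : 'I_n * 'I_n & (p.1 < p.2)%N && (s p.2 < s p.1)%N].
have lift_lt (k : 'I_n.+1) (a b : 'I_n) : (lift k a < lift k b)%N = (a < b)%N.
  by rewrite /= /bump; lia.
have -> : inversions t = #|A :|: B|.
  rewrite /inversions; congr #|pred_of_set _|; apply/setP => -[x y]; rewrite !inE /=.
  apply/andP/orP.
    case: (unliftP ord0 x) => [x'|] -> [xy txy]; last first.
      by left; apply/imsetP; exists y; rewrite ?inE // -t0.
    case: (unliftP ord0 y) xy txy => [y'|] -> // xy; rewrite !tl => txy.
    right; apply/imsetP; exists (x', y'); rewrite ?inE //=.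
    by move: txy; rewrite lift_lt => ->; rewrite lift_lt in xy; rewrite xy.
  case=> [/imsetP[i]|/imsetP[[a b]]]; rewrite inE => /= h [-> ->].
    rewrite t0 h; split=> //; rewrite lt0n; apply/eqP => i0.
    by move: h; rewrite (_ : i = ord0) ?t0 ?ltnn //; apply/val_inj.
  by rewrite !tl !lift_lt; case/andP: h.
rewrite cardsU (_ : A :&: B = set0) ?cards0 ?subn0; last first.
  apply/setP => x; rewrite !inE; apply/negP => /andP[/imsetP[i _ ->] /imsetP[p _ []]].
  by [].
rewrite /A /B !card_imset; last 2 first.
- move=> [a b] [c d] e; congr (_, _); apply: (@lift_inj _ ord0).
    exact: (congr1 fst e).
  exact: (congr1 snd e).
- by move=> a b [].
congr (_ + _)%N.
rewrite (_ : [set i | _] = t @^-1: [set i : 'I_n.+1 | i < j]%N); last first.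
  by apply/setP => i; rewrite !inE.
rewrite card_preimset; last exact: perm_inj.
rewrite -sum1dep_card -(big_ord_widen n.+1 (fun=> 1%N) (ltnW (ltn_ord j))).
by rewrite sum1_card card_ord.
Qed.

Lemma lift_perm_bij n :
  bijective (fun p : 'I_n.+1 * 'S_n => lift_perm ord0 p.1 p.2).
Proof.
apply: inj_card_bij => [[j s] [j' s'] /= e|].
  have ej : j = j' by move/permP/(_ ord0): e; rewrite !lift_perm_id.
  congr (_, _) => //; apply/permP => i; apply: (@lift_inj _ j).
  by move/permP/(_ (lift ord0 i)): e; rewrite -ej !lift_perm_lift.
by rewrite card_prod !card_Sn card_ord factS.
Qed.

Lemma sum_inversions n :
  \sum_(s : 'S_n) 'X^(inversions s) = \prod_(i < n) qint i.+1.
Proof.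
elim: n => [|n IHn].
  rewrite big_ord0 (big_pred1 1%g) => [|s]; last by apply/esym/eqP/permP => -[].
  by rewrite (_ : inversions _ = 0%N) //; apply: eq_card0 => -[[]].
have [g fK gK] := lift_perm_bij n.
rewrite (reindex _ (onW_bij _ (Bijective fK gK))) big_ord_recr /= -IHn mulrC.
rewrite -(pair_bigA_idem _ (fun j s => 'X^(inversions (lift_perm ord0 j s)))) /=; last exact: addr0.
rewrite mulr_suml; apply: eq_bigr => j _; rewrite mulr_sumr.
by apply: eq_bigr => s _; rewrite inversions_lift exprD.
Qed.

Lemma nb_perms_coef n m : nb_perms n m = ((\prod_(i < n) qint i.+1 : {poly nat})`_m).
Proof.
rewrite -sum_inversions coef_sum /nb_perms -sum1dep_card big_mkcond.
by apply: eq_bigr => s _; rewrite coefXn eq_sym; case: eqP.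
Qed.

(** * Counting walks and weak compositions *)

Section Walks.
Local Open Scope nat_scope.

Fixpoint walks (a k h : nat) : nat :=
  if k is k'.+1 then
    (if h is h'.+1 then walks a k' h' else 0) + walks a k' h.+1
  else h == a.

Lemma walksS0 a k : walks a k.+1 0 = walks a k 1.
Proof. by []. Qed.

Lemma walksSS a k h : walks a k.+1 h.+1 = walks a k h + walks a k h.+2.
Proof. by []. Qed.

Lemma walks_gt k h : k < h -> walks 0 k h = 0.
Proof.
elim: k h => [|k IHk] [|h] //= kh; rewrite !IHk //; lia.
Qed.

Lemma wpaths_gt L k h : k < h -> wpaths L k h = 0%R.
Proof.
elim: k h => [|k IHk] [|h] //= kh; rewrite !IHk ?mulr0 ?addr0 //; lia.
Qed.

(** The reflection principle, in the form of Pascal's rule: among all walks of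
    [h + 2 * d] steps ending at [h], those that become negative are as many as the
    walks ending at [- h - 2].  The [match] stands for a binomial coefficient with
    lower index [d - 1], zero for [d = 0]. *)
Lemma walks_bin h d :
  walks 0 (h + d.*2) h + (if d is d'.+1 then 'C(h + d.*2, d') else 0)
  = 'C(h + d.*2, d).
Proof.
have [k] := ubnP (h + d.*2); elim: k h d => // k IHk h d.
case: d => [|d] hk.
  case: h hk => [|h] hk; first by rewrite bin0.
  have := IHk h 0; rewrite !addn0 /= !bin0 => IH.
  by rewrite IH ?walks_gt //; move: hk; rewrite addn0.
have -> : h + d.+1.*2 = (h.+1 + d.*2).+1 by lia.
have IH := IHk h.+1 d ltac:(lia).
case: h hk IH => [|h] hk IH.
  have sym : 'C(1 + d.*2, d.+1) = 'C(1 + d.*2, d).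
    by rewrite -bin_sub; [congr 'C(_, _)|]; lia.
  rewrite walksS0; move: (1 + d.*2) sym IH => N sym IH.
  by case: d {hk} sym IH => [|d] sym IH; rewrite ?binS ?bin0; lia.
rewrite walksSS; have := IHk h d.+1 ltac:(lia).
have -> : h + d.+1.*2 = h.+2 + d.*2 by lia.
move: (h.+2 + d.*2) IH => N IH IH1.
by case: d {hk} IH IH1 => [|d] IH IH1; rewrite ?binS ?bin0; lia.
Qed.

Lemma walks_ballot h d : (h + d).+1 * walks 0 (h + d.*2) h = h.+1 * 'C(h + d.*2, d).
Proof.
have := walks_bin h d; case: d => [|d]; first by rewrite !addn0 !bin0; lia.
set N := h + _ => e.
have := mul_bin_left N d; have -> : N - d = (h + d.+1).+1 by rewrite /N; lia.
nia.
Qed.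

Lemma walks_catalan n : walks 0 (2 * n) 0 = catalan n.
Proof.
have := walks_ballot 0 n; rewrite !add0n mul1n -mul2n /catalan => <-.
by rewrite mulKn.
Qed.

Lemma bin_central n j : j <= n -> 'C(2 * n, n - j) <= 'C(2 * n, n).
Proof.
elim: j => [|j IHj] jn; first by rewrite subn0.
apply: leq_trans (IHj (ltnW jn)).
have := mul_bin_left (2 * n) (n - j.+1).
have -> : (n - j.+1).+1 = n - j by lia.
nia.
Qed.

(** The ballot formula multiplies a binomial coefficient, largest in the middle, by
    [(2 * j + 1) / (n + j + 1)]. *)
Lemma walks_even_le n j : walks 0 (2 * n) (2 * j) <= (2 * j).+1 * walks 0 (2 * n) 0.
Proof.
have [nj|jn] := ltnP n j; first by rewrite walks_gt //; lia.
have := walks_ballot (2 * j) (n - j); have -> : 2 * j + (n - j).*2 = 2 * n by lia.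
have := walks_ballot 0 n; rewrite add0n -mul2n mul1n => e0.
have -> : 2 * j + (n - j) = n + j by lia.
move=> ej; rewrite -(leq_pmul2l (isT : 0 < (n + j).+1)) ej.
apply: (@leq_trans ((2 * j).+1 * (n.+1 * walks 0 (2 * n) 0))).
  by rewrite add0n in e0; rewrite e0 leq_mul2l bin_central ?orbT.
by rewrite mulnCA leq_mul2r; lia.
Qed.

(** The last two steps of a Dyck path start at height 0 or 2, and at most three
    times as many walks end at height 2 as at height 0. *)
Lemma catalanS_le n : catalan n.+1 <= 4 * catalan n.
Proof.
rewrite -!walks_catalan (_ : 2 * n.+1 = (2 * n).+2) /=; last by lia.
by have := walks_even_le n 1; rewrite muln1 add0n; lia.
Qed.

Lemma catalan_le n l : catalan (n + l) <= 4 ^ l * catalan n.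
Proof.
elim: l => [|l IHl]; first by rewrite addn0 mul1n.
rewrite addnS expnS -mulnA; apply: leq_trans (catalanS_le _) _.
by rewrite leq_mul2l IHl.
Qed.

Arguments walks : simpl never.

Lemma walks_0 a h : walks a 0 h = (h == a).
Proof. by []. Qed.

(** Cut the walk at its last step from height [h] to [h + 1]; the rest, seen from
    height [h + 1], stays nonnegative. *)
Lemma walks_last_exit h k i :
  walks 0 k (h + i).+1 = \sum_(t < k) walks 0 t h * walks 0 (k - t.+1) i.
Proof.
elim: k i => [|k IHk] i; first by rewrite big_ord0.
rewrite big_ord_recr /= subnn walksSS.
have subE (t : 'I_k) : k.+1 - t.+1 = (k - t.+1).+1 by have := ltn_ord t; lia.
case: i => [|i].
  rewrite walks_0 addn0 muln1 addnC; congr (_ + _); rewrite -[h.+2](addn1 h.+1) addSn IHk.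
  by apply: eq_bigr => t _; rewrite subE walksS0.
rewrite walks_0 muln0 addn0 addnS IHk -!addnS !addnS -addnS -addnS IHk -big_split.
by apply: eq_bigr => t _; rewrite subE walksSS mulnDr.
Qed.

Lemma walks_first_step a k b :
  walks a k.+1 b = (if a is a'.+1 then walks a' k b else 0) + walks a.+1 k b.
Proof.
elim: k b => [|k IHk] b.
  by case: a b => [|a] [|b]; rewrite ?walksS0 ?walksSS !walks_0 ?eqSS; lia.
case: b => [|b].
  by rewrite walksS0 IHk; case: a {IHk} => [|a]; rewrite !walksS0.
by rewrite walksSS !IHk; case: a {IHk} => [|a]; rewrite !walksSS; lia.
Qed.

Lemma walks_sym a k b : walks a k b = walks b k a.
Proof.
elim: k a b => [|k IHk] a b; first by rewrite !walks_0 eq_sym.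
by rewrite walks_first_step; case: a => [|a]; rewrite ?walksS0 ?walksSS !(IHk _ b).
Qed.

(** The walks from 0 to [h] with a marked down step from height [j + 1]: one walk
    up to the marked step and one after it. *)
Definition marked (j k h : nat) : nat :=
  \sum_(t < k) walks 0 t j.+1 * walks j (k - t.+1) h.

Lemma markedS j k h : marked j k.+1 h =
  (if h is h'.+1 then marked j k h' else 0) + marked j k h.+1
    + (h == j) * walks 0 k h.+1.
Proof.
rewrite /marked big_ord_recr /= subnn walks_0; congr (_ + _); last first.
  by rewrite mulnC; case: eqP => [->|].
have subE (t : 'I_k) : k.+1 - t.+1 = (k - t.+1).+1 by have := ltn_ord t; lia.
case: h => [|h].
  by apply: eq_bigr => t _; rewrite subE walksS0.
by rewrite -big_split; apply: eq_bigr => t _; rewrite subE walksSS mulnDr.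
Qed.

(** Turn the marked down step into an up step and reverse what follows it: the
    marked step becomes the last exit from height [j + 1] of a walk ending at
    height [2 * (j + 1)].  Hence the average number of down steps at each height
    of a Dyck path is a quotient of two ballot numbers. *)
Lemma marked0 j k : marked j k 0 = walks 0 k (2 * j.+1).
Proof.
have -> : 2 * j.+1 = (j.+1 + j).+1 by lia.
by rewrite walks_last_exit; apply: eq_bigr => t _; rewrite (walks_sym j).
Qed.

End Walks.

Section Compositions.
Local Open Scope nat_scope.

Lemma weak_compositionsS n m : weak_compositions n.+1 m = 'C(n + m, n).
Proof. by rewrite /weak_compositions /= addSn !subn1. Qed.

Lemma weak_compositions_sum n m :
  \sum_(x < m.+1) weak_compositions n x = weak_compositions n.+1 m.
Proof.
elim: m => [|m IHm].
  by rewrite big_ord_recl big_ord0 addn0 /= weak_compositionsS addn0 binn; case: n => // n;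
   rewrite weak_compositionsS addn0 binn.
rewrite big_ord_recr /= IHm; case: n {IHm} => [|n]; first by rewrite !weak_compositionsS !bin0.
by rewrite !weak_compositionsS [n.+1 + m.+1]addnS [RHS]binS addSnnS.
Qed.

(** The weak compositions of [m] in [d] unknowns, a given one of which is at least
    [J]; meaningful for [0 < d]. *)
Definition compositions_ge (d m J : nat) : nat :=
  if J <= m then weak_compositions d (m - J) else 0.

Lemma sum_below_split (F : nat -> nat) H m :
  \sum_(x < m.+1) F x = \sum_(x < H | x <= m) F (m - x)
    + (if H <= m then \sum_(x < (m - H).+1) F x else 0).
Proof.
elim: H => [|H IHH]; first by rewrite big_ord0 subn0.
have -> : \sum_(x < H.+1 | x <= m) F (m - x) =
    \sum_(x < H | x <= m) F (m - x) + (if H <= m then F (m - H) else 0).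
  by rewrite big_mkcond big_ord_recr -big_mkcond.
rewrite {}IHH -addnA; congr (_ + _).
have [Hm|mH|->] := ltngtP H m; rewrite ?ltnn //=.
  by rewrite subnSK // big_ord_recr addnC.
by rewrite subnn big_ord_recr big_ord0 addn0.
Qed.

(** Split according to whether the new unknown is below [H]. *)
Lemma sum_weak_compositions_below d H m :
  weak_compositions d.+1 m =
  \sum_(x < H | x <= m) weak_compositions d (m - x) + compositions_ge d.+1 m H.
Proof.
rewrite -weak_compositions_sum (sum_below_split _ H); congr (_ + _).
by rewrite /compositions_ge; case: leqP => // _; rewrite weak_compositions_sum.
Qed.

Lemma sum_compositions_ge_le d J H m :
  \sum_(x < H | x <= m) compositions_ge d (m - x) J <= compositions_ge d.+1 m J.
Proof.
apply: (@leq_trans (\sum_(x < m.+1) compositions_ge d x J)).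
  by rewrite (sum_below_split (compositions_ge d ^~ J) H) leq_addr.
rewrite /compositions_ge; case: (leqP J m) => Jm.
  rewrite -weak_compositions_sum.
  rewrite -(big_mkord xpredT (fun x => if J <= x then weak_compositions d (x - J) else 0)).
  rewrite (@big_cat_nat _ _ _ J) ?leqW //= big_nat big1 ?add0n; last by move=> x /=; case: leqP.
  rewrite -{1}[J]add0n big_addn subSn // -(big_mkord xpredT) leq_sum // => x _.
  by rewrite leq_addl addnK.
by rewrite big1 // => x _; rewrite leqNgt (leq_trans (ltn_ord x)).
Qed.

(** The quotient of the two numbers of compositions is [m / (d + m - 1)], which is
    at most [s / (s + 1)] for [m <= s * (d - 1)]. *)
Lemma weak_compositions_pred s d m : 0 < d -> 0 < m -> m <= s * d.-1 ->
  s.+1 * weak_compositions d m.-1 <= s * weak_compositions d m.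
Proof.
case: d m => // d [|m] // _ _ /= md; rewrite !weak_compositionsS.
have := mul_bin_down (d + m.+1) d; have -> : d + m.+1 - d = m.+1 by lia.
rewrite addnS /= => e; rewrite -(leq_pmul2l (isT : 0 < m.+1)).
by rewrite [leqRHS]mulnCA -e; nia.
Qed.

Lemma compositions_ge_le s d m J : 0 < d -> m <= s * d.-1 ->
  s.+1 ^ J * compositions_ge d m J <= s ^ J * weak_compositions d m.
Proof.
move=> d0 md; elim: J => [|J IHJ]; first by rewrite /compositions_ge subn0 !mul1n.
have [Jm|mJ] := ltnP J m; last by rewrite {1}/compositions_ge ltnNge mJ muln0.
apply: (@leq_trans (s * (s.+1 ^ J * compositions_ge d m J))); last first.
  by rewrite (expnS s) -mulnA leq_mul2l IHJ orbT.
rewrite /compositions_ge Jm (ltnW Jm) expnSr -mulnA [leqRHS]mulnCA leq_mul2l subnS.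
by rewrite weak_compositions_pred ?orbT //; lia.
Qed.

End Compositions.

(** * Upper bounds *)

Lemma coef_qintM h (p : {poly nat}) m :
  (qint h * p)`_m = (\sum_(x < h | x <= m) (p`_(m - x)%N)%R)%N.
Proof.
rewrite /qint mulr_suml coef_sum [RHS]big_mkcond.
by apply: eq_bigr => x _; rewrite coefXnM ltnNge; case: leqP.
Qed.

Definition qfact n : {poly nat} := \prod_(i < n) qint i.+1.

Lemma qfactS n : qfact n.+1 = qfact n * qint n.+1.
Proof. by rewrite /qfact big_ord_recr. Qed.

Definition coef_le (p q : {poly nat}) := forall i, ((p`_i)%R <= (q`_i)%R)%N.

Lemma coef_leD p q p' q' : coef_le p q -> coef_le p' q' -> coef_le (p + p') (q + q').
Proof. by move=> h h' i; rewrite !coefD leq_add. Qed.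

Lemma coef_leM p q p' q' : coef_le p q -> coef_le p' q' -> coef_le (p * p') (q * q').
Proof. by move=> h h' i; rewrite !coefM; apply: leq_sum => j _; apply: leq_mul. Qed.

Lemma coef_le_refl p : coef_le p p.
Proof. by []. Qed.

Lemma coef_le_trans q p r : coef_le p q -> coef_le q r -> coef_le p r.
Proof. by move=> pq qr i; apply: leq_trans (pq i) (qr i). Qed.

Lemma coef_le_qint m n : (m <= n)%N -> coef_le (qint m) (qint n).
Proof.
move=> mn i; rewrite /qint !coef_sum.
under eq_bigr do rewrite coefXn; under [leqRHS]eq_bigr do rewrite coefXn.
rewrite -!(big_mkord xpredT (fun j => (i == j)%:R)) (@big_cat_nat _ _ _ m 0 n) //=.
exact: leq_addr.
Qed.

(** The factor [qfact h] accounts in advance for closing the [h] open chords, so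
    that both kinds of steps preserve the bound: a closing moves the factor
    [qint h.+1] from the walk to [qfact], and an opening multiplies the left side
    by [qint h] and the right side by [qint (h + d)], which is larger.  Here
    [h + d] is the number of openings made. *)
Lemma wpaths_le_qfact h d : coef_le (wpaths 0 (h + d.*2) h * qfact h)
                          ((walks 0 (h + d.*2) h)%:R * qfact (h + d)).
Proof.
have [k] := ubnP (h + d.*2)%N; elim: k h d => // k IHk h d hk.
case kE: (h + d.*2)%N hk => [|N] hk.
  have [-> ->] : h = 0%N /\ d = 0%N by lia.
  by rewrite !addn0; apply: coef_le_refl.
rewrite [wpaths _ _ _]/= [walks _ _ _]/= mulrDl natrD mulrDl; apply: coef_leD.
  case: h kE hk => [|h] kE hk; first by rewrite !mul0r; apply: coef_le_refl.
  have := IHk h d; have -> : (h + d.*2 = N)%N by lia.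
  move=> /(_ ltac:(lia)) IH; rewrite qfactS mulrA addSn qfactS mulrA.
  by apply: coef_leM IH (coef_le_qint _); lia.
case: d kE hk => [|d] kE hk.
  by rewrite wpaths_gt ?walks_gt; [rewrite mulr0 !mul0r; apply: coef_le_refl| lia| lia].
have := IHk h.+1 d; have -> : (h.+1 + d.*2 = N)%N by lia.
move=> /(_ ltac:(lia)); rewrite qfactS addSnnS => IH.
by rewrite add0n -mulrA [qint _ * _]mulrC -mulrA.
Qed.

Lemma nb_diagrams_le n m : (nb_diagrams n m <= catalan n * nb_perms n m)%N.
Proof.
rewrite nb_diagrams_wpaths nb_perms_coef -walks_catalan.
have := wpaths_le_qfact 0 n m; rewrite add0n -mul2n add0n /qfact big_ord0 mulr1.
by rewrite mulr_natl coefMn -mulr_natl natn.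
Qed.

Lemma nb_perms_le n m : (nb_perms n m <= weak_compositions n m)%N.
Proof.
rewrite nb_perms_coef -/(qfact n); elim: n m => [|n IHn] m.
  by rewrite /qfact big_ord0 coef1 natn.
rewrite qfactS mulrC coef_qintM (sum_weak_compositions_below _ n.+1).
by apply: leq_trans (leq_addr _ _); apply: leq_sum => x _.
Qed.

(** * Union bound on lifted paths *)

Section LiftedPaths.
Local Open Scope nat_scope.

(** A walk with [d] down steps is labelled by a composition of [m] in [d] unknowns,
    and the labelling is admissible unless some label reaches its bound; the sum
    on the right counts walks, labellings and a marked down step with an excessive
    label.  In the induction on the length, the label of a last down step is split
    off by [sum_weak_compositions_below]. *)
Lemma wpaths_union_bound L N h d m : h + d.*2 < N ->
  walks 0 (h + d.*2) h * weak_compositions d m <=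
  ((wpaths L (h + d.*2) h)`_m)%R +
  \sum_(j < N) marked j (h + d.*2) h * compositions_ge d m (L + j.+1).
Proof.
have [k] := ubnP (h + d.*2); elim: k h d m => // k IHk h d m hk.
case kE: (h + d.*2) hk => [|K] hk KN.
  have [-> ->] : h = 0 /\ d = 0 by lia.
  by rewrite coef1 natn mul1n leq_addr.
pose up := if h is h'.+1 then walks 0 K h' else 0.
pose wup := (if h is h'.+1 then wpaths L K h' else 0)%R.
pose mup j := if h is h'.+1 then marked j K h' else 0.
have -> : walks 0 K.+1 h = up + walks 0 K h.+1 by [].
have -> : wpaths L K.+1 h = (wup + qint (L + h.+1) * wpaths L K h.+1)%R by [].
have Hup : up * weak_compositions d m <=
    (wup`_m)%R + \sum_(j < N) mup j * compositions_ge d m (L + j.+1).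
  rewrite /up /wup /mup; case: h kE hk {up wup mup} => [|h] kE hk; first by rewrite mul0n.
  by have := IHk h d m; have -> : h + d.*2 = K by [lia]; apply; lia.
have Hdown : walks 0 K h.+1 * weak_compositions d m <=
    ((qint (L + h.+1) * wpaths L K h.+1)`_m)%R
    + \sum_(j < N) marked j K h.+1 * compositions_ge d m (L + j.+1)
    + walks 0 K h.+1 * compositions_ge d m (L + h.+1).
  case: d kE hk {Hup} => [|d] kE hk; first by rewrite walks_gt //; lia.
  rewrite (sum_weak_compositions_below _ (L + h.+1)) mulnDr leq_add2r coef_qintM.
  rewrite big_distrr /=.
  apply: (@leq_trans (\sum_(x < L + h.+1 | x <= m) (((wpaths L K h.+1)`_(m - x)%N)%R +
     \sum_(j < N) marked j K h.+1 * compositions_ge d (m - x) (L + j.+1)))).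
    apply: leq_sum => x _; have := IHk h.+1 d (m - x).
    by have -> : h.+1 + d.*2 = K by [lia]; apply; lia.
  rewrite big_split /= leq_add2l exchange_big leq_sum // => j _.
  by rewrite -big_distrr leq_mul2l sum_compositions_ge_le orbT.
have -> : \sum_(j < N) marked j K.+1 h * compositions_ge d m (L + j.+1) =
    \sum_(j < N) mup j * compositions_ge d m (L + j.+1)
    + \sum_(j < N) marked j K h.+1 * compositions_ge d m (L + j.+1)
    + walks 0 K h.+1 * compositions_ge d m (L + h.+1).
  have hN : h < N by lia.
  rewrite (eq_bigr (fun j : 'I_N => mup j * compositions_ge d m (L + j.+1)
     + marked j K h.+1 * compositions_ge d m (L + j.+1)
     + (h == j) * walks 0 K h.+1 * compositions_ge d m (L + j.+1))); last first.
    by move=> j _; rewrite markedS !mulnDl.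
  rewrite !big_split /=; congr (_ + _ + _).
  rewrite (bigD1 (Ordinal hN)) //= eqxx mul1n big1 ?addn0 // => j.
  by rewrite -val_eqE /= eq_sym => /negbTE ->.
have -> : ((wup + qint (L + h.+1) * wpaths L K h.+1)`_m)%R =
    (wup`_m)%R + ((qint (L + h.+1) * wpaths L K h.+1)`_m)%R by rewrite coefD.
by rewrite mulnDl; lia.
Qed.

(** Precede the walk by [L] up steps. *)
Lemma wpaths_lift L k h : coef_le (wpaths L k h) (wpaths 0 (L + k) (L + h)).
Proof.
have base : coef_le 1%R (wpaths 0 L L).
  elim: L => [|L IHL]; first exact: coef_le_refl.
  by move=> i /=; rewrite coefD; apply: leq_trans (leq_addr _ _); apply: IHL.
elim: k h => [|k IHk] h.
  case: h => [|h]; first by rewrite !addn0.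
  by move=> i /=; rewrite coef0.
rewrite addnS; case: h => [|h].
  move=> i; rewrite /= addn0 add0r coefD; apply: leq_trans (leq_addl _ _).
  by have := coef_leM (@coef_le_refl (qint (L + 1))) (IHk 1); rewrite addn1 => /(_ i).
rewrite addnS /=; apply: coef_leD; first exact: IHk.
by apply: coef_leM; [rewrite !addnS; apply: coef_le_refl | rewrite -!addnS; apply: IHk].
Qed.

(** Follow the walk by a straight descent to height 0. *)
Lemma wpaths_descent k h : coef_le (qfact h * wpaths 0 k h)%R (wpaths 0 (k + h) 0).
Proof.
elim: h k => [|h IHh] k.
  by rewrite /qfact big_ord0 mul1r addn0; apply: coef_le_refl.
rewrite qfactS -mulrA addnS -addSn; apply: coef_le_trans (IHh k.+1).
apply: coef_leM (@coef_le_refl _) _ => i /=; rewrite coefD; exact: leq_addl.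
Qed.

Lemma nb_diagrams_ge L n m :
  ((qfact L * wpaths L (2 * n) 0)`_m)%R <= nb_diagrams (n + L) m.
Proof.
rewrite nb_diagrams_wpaths; have -> : 2 * (n + L) = L + 2 * n + L by lia.
apply: (coef_le_trans _ (@wpaths_descent (L + 2 * n) L)).
by apply: coef_leM (@coef_le_refl _) _; have := @wpaths_lift L (2 * n) 0; rewrite addn0.
Qed.

End LiftedPaths.

(** * The lower bound, non-asymptotically *)

Import Order.TTheory Num.Theory.

Section Ratio.
Variables (R : realFieldType) (p : nat).
Local Notation s := (p.+1%:R : R).
Local Notation rho := (p%:R / s).

Lemma scale_gt0 : 0 < s. Proof. exact: ltr0Sn. Qed.

Lemma ratio_mul_scale : rho * s = s - 1.
Proof. by rewrite divfK ?gt_eqF ?scale_gt0 // -natr1 addrK. Qed.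

Lemma ratio_ge0 : 0 <= rho.
Proof. by rewrite divr_ge0. Qed.

Lemma ratio_le1 : rho <= 1.
Proof. by rewrite ler_pdivrMr ?scale_gt0 // mul1r ler_nat. Qed.

Let rho_ge0 := ratio_ge0.

(** The full series has sum [(1 + rho) / (1 - rho) ^+ 2 - 1], where [1 - rho] is
    the inverse of [s]. *)
Lemma sum_height_ratio N :
  \sum_(j < N) (2 * j.+1).+1%:R * rho ^+ j.+1 <= 2 * s ^+ 2.
Proof.
(* the second term is an upper bound of the tail of the series *)
suff: \sum_(j < N) (2 * j.+1).+1%:R * rho ^+ j.+1
    + rho ^+ N.+1 * (2 * N.+1%:R * s + 2 * s ^+ 2) <= 2 * s ^+ 2.
  apply: le_trans; rewrite lerDl mulr_ge0 ?exprn_ge0 // addr_ge0 //.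
    by rewrite !mulr_ge0 ?ler0n ?ltW.
  by rewrite mulr_ge0 ?exprn_ge0 ?ltW.
elim: N => [|N IHN].
  rewrite big_ord0 add0r expr1 mulr1.
  have -> : rho * (2 * s + 2 * s ^+ 2) = (rho * s) * (2 + 2 * s) by ring.
  by rewrite ratio_mul_scale; have := scale_gt0; nra.
apply: le_trans IHN; rewrite big_ord_recr /= -addrA lerD2l.
have -> : rho ^+ N.+2 * (2 * N.+2%:R * s + 2 * s ^+ 2)
  = rho ^+ N.+1 * ((rho * s) * (2 * N.+2%:R + 2 * s)) by rewrite (exprSr rho N.+1); ring.
rewrite ratio_mul_scale mulrC -mulrDr ler_wpM2l ?exprn_ge0 //.
have -> : (2 * N.+1).+1%:R = 2 * N%:R + 3 :> R by rewrite -natr1 natrM -natr1; ring.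
have -> : N.+2%:R = N%:R + 2 :> R by rewrite -natr1 -natr1; ring.
have -> : N.+1%:R = N%:R + 1 :> R by rewrite -natr1.
by have := ler0n R N; have := scale_gt0; nra.
Qed.

Lemma compositions_ge_le_ratio d m J : (0 < d)%N -> (m <= p * d.-1)%N ->
  (compositions_ge d m J)%:R <= rho ^+ J * (weak_compositions d m)%:R.
Proof.
move=> d0 /(compositions_ge_le J d0); rewrite -(ler_nat R) !natrM !natrX => h.
rewrite -(ler_pM2l (exprn_gt0 J scale_gt0)); apply: le_trans h _.
by rewrite mulrA -exprMn [s * rho]mulrC ratio_mul_scale -natr1 addrK.
Qed.

(** The expected number of violated bounds is at most [rho ^+ L * (2 * s ^+ 2)], so
    at least half of the labelled paths are admissible. *)
Lemma wpaths_lifted_ge L n m : (0 < n)%N -> (m <= p * n.-1)%N ->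
  rho ^+ L * (4 * s ^+ 2) <= 1 ->
  2^-1 * (catalan n)%:R * (weak_compositions n m)%:R
    <= ((wpaths L (2 * n) 0)`_m)%R%:R :> R.
Proof.
move=> n0 mn small; set C := (catalan n)%:R; set W := (weak_compositions n m)%:R.
have := @wpaths_union_bound L (2 * n).+1 0 n m; rewrite add0n -mul2n => /(_ (leqnn _)).
rewrite walks_catalan -(ler_nat R) natrD natrM -/C -/W natr_sum => main.
have C0 : 0 <= C by apply: ler0n.
have W0 : 0 <= W by apply: ler0n.
suff : \sum_(j < (2 * n).+1)
    (marked j (2 * n) 0 * compositions_ge n m (L + j.+1))%N%:R <= 2^-1 * C * W.
  by move=> h; lra.
apply: (@le_trans _ _ (\sum_(j < (2 * n).+1)
    C * W * rho ^+ L * ((2 * j.+1).+1%:R * rho ^+ j.+1))).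
  apply: ler_sum => j _; rewrite marked0 natrM.
  have -> : C * W * rho ^+ L * ((2 * j.+1).+1%:R * rho ^+ j.+1) =
    ((2 * j.+1).+1%:R * C) * (rho ^+ (L + j.+1) * W) by rewrite exprD; ring.
  apply: ler_pM; rewrite ?ler0n ?compositions_ge_le_ratio //.
  by rewrite -natrM ler_nat -walks_catalan walks_even_le.
rewrite -mulr_sumr.
apply: le_trans (ler_wpM2l _ (sum_height_ratio _)) _; first by rewrite !mulr_ge0 ?exprn_ge0.
have -> : C * W * rho ^+ L * (2 * s ^+ 2) = C * W * (2^-1 * (rho ^+ L * (4 * s ^+ 2))) by field.
have -> : 2^-1 * C * W = C * W * (2^-1 * 1) by field.
by rewrite !ler_wpM2l ?mulr_ge0 ?invr_ge0.
Qed.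

(** Unknowns bounded by [1], ..., [i] are added one at a time; the one
    bounded by [l] keeps at least the fraction [1 - rho ^+ l] of the compositions: the condition
    on [m] for this only weakens when the number of unknowns grows. *)
Lemma qfact_mul_ge i n M (g : {poly nat}) (c : R) : 0 <= c -> (0 < n)%N -> (M <= p * n.-1)%N ->
  (forall m, (m <= M)%N -> c * (weak_compositions n m)%:R <= (g`_m)%R%:R) ->
  forall m, (m <= M)%N ->
  c * (\prod_(l < i) (1 - rho ^+ l.+1)) * (weak_compositions (i + n) m)%:R
    <= ((qfact i * g)`_m)%R%:R.
Proof.
move=> c0 n0 Mn hg; elim: i => [|i IHi] m mM.
  by rewrite big_ord0 mulr1 /qfact big_ord0 mul1r; apply: hg.
rewrite qfactS [qfact i * _]mulrC -[_ * g]mulrA coef_qintM natr_sum big_ord_recr /=.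
set c' := \prod_(l < i) _ in IHi *.
have c'0 : 0 <= c * c'.
  rewrite mulr_ge0 // prodr_ge0 // => l _; rewrite subr_ge0 exprn_ile1 //.
  exact: ratio_le1.
apply: (@le_trans _ _ (\sum_(x < i.+1 | (x <= m)%N)
   c * c' * (weak_compositions (i + n) (m - x))%:R)); last first.
  by apply: ler_sum => x _; apply: IHi; lia.
have := sum_weak_compositions_below (i + n) i.+1 m.
move=> /(congr1 (fun k => k%:R : R)); rewrite natrD natr_sum -mulr_sumr addSn => e.
have := @compositions_ge_le_ratio (i + n).+1 m i.+1 isT; rewrite /= => /(_ ltac:(nia)) hw.
rewrite mulrA -mulrA ler_wpM2l // mulrBl mul1r; lra.
Qed.

(** Each factor is at least [l / (s + l)], since [rho ^+ l <= s / (s + l)], and the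
    product of these quotients is the inverse of a binomial coefficient. *)
Lemma prod_ratio_ge L :
  1 <= (\prod_(l < L) (1 - rho ^+ l.+1)) * 'C(L + p.+1, L)%:R.
Proof.
have rho_le i : rho ^+ i * (s + i%:R) <= s.
  elim: i => [|i IHi]; first by rewrite mul1r addr0.
  apply: le_trans IHi; rewrite exprSr -mulrA ler_wpM2l ?exprn_ge0 //.
  have -> : rho * (s + i.+1%:R) = rho * s + rho * i.+1%:R by ring.
  have : rho * i.+1%:R <= i.+1%:R by rewrite ler_piMl // ratio_le1.
  by rewrite ratio_mul_scale; move: (rho * _) => u; rewrite -(natr1 i); lra.
elim: L => [|L IHL]; first by rewrite big_ord0 bin0 mulr1.
rewrite big_ord_recr /= -mulrA; apply: le_trans IHL _.
rewrite ler_wpM2l //.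
  rewrite prodr_ge0 // => l _; rewrite subr_ge0 exprn_ile1 //.
  exact: ratio_le1.
have e : L.+1%:R * 'C(L.+1 + p.+1, L.+1)%:R = (s + L.+1%:R) * 'C(L + p.+1, L)%:R :> R.
  rewrite -natrD -!natrM; congr (_%:R).
  by rewrite addSn -mul_bin_diag; congr (_ * _)%N; lia.
rewrite -(ler_pM2l (ltr0Sn R L)) mulrCA e mulrA ler_wpM2r //.
by rewrite mulrBl mul1r; have := rho_le L.+1; lra.
Qed.

(** Shortening the Catalan number costs [4 ^+ L] and the final descent costs
    ['C(L + s, L)].  The two are estimated together: the binomial coefficient is
    the coefficient of [4 ^+ L] in the expansion of [(1 + 4) ^+ (L + s)]. *)
Lemma nb_diagrams_lower L n m : (L < n)%N -> (m <= p * (n - L).-1)%N ->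
  rho ^+ L * (4 * s ^+ 2) <= 1 ->
  (catalan n)%:R * (weak_compositions n m)%:R
    <= 2 * 5 ^+ (L + p.+1) * (nb_diagrams n m)%:R :> R.
Proof.
move=> Ln mp small; have nL : n = (n - L + L)%N by lia.
have n0 : (0 < n - L)%N by lia.
have bulk k : (k <= p * (n - L).-1)%N ->
   2^-1 * (catalan (n - L))%:R * (weak_compositions (n - L) k)%:R
   <= ((wpaths L (2 * (n - L)) 0)`_k)%R%:R :> R by move=> hk; apply: wpaths_lifted_ge.
have c0 : 0 <= 2^-1 * (catalan (n - L))%:R :> R by rewrite mulr_ge0 ?invr_ge0.
have := @qfact_mul_ge L _ _ _ _ c0 n0 (leqnn _) bulk m mp.
rewrite addnC -nL; set beta := \prod_(l < L) _ => tail.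
have T_ge : ((qfact L * wpaths L (2 * (n - L)) 0)`_m)%R%:R <= (nb_diagrams n m)%:R :> R.
  by rewrite ler_nat [in leqRHS]nL nb_diagrams_ge.
have cat : (catalan n)%:R <= 4 ^+ L * (catalan (n - L))%:R :> R.
  by rewrite -natrX -natrM ler_nat [in leqLHS]nL catalan_le.
have bin5 : 'C(L + p.+1, L)%:R * 4 ^+ L <= 5 ^+ (L + p.+1) :> R.
  rewrite -!natrX -natrM ler_nat (_ : 5 = 1 + 4)%N // expnDn.
  have hL : (L < (L + p.+1).+1)%N by lia.
  by rewrite (bigD1 (Ordinal hL)) //= exp1n mul1n leq_addr.
have := prod_ratio_ge L; rewrite -/beta => b1.
have b0 : 0 <= beta.
  have B0 : 0 <= 'C(L + p.+1, L)%:R :> R by [].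
  by rewrite leNgt; apply/negP => bn; nra.
set C := (catalan n)%:R in cat *; set C' := (catalan (n - L))%:R in cat tail c0 *.
set W := (weak_compositions n m)%:R in tail *.
set T := (nb_diagrams n m)%:R in T_ge *.
have W0 : 0 <= W by apply: ler0n.
have C'0 : 0 <= C' by apply: ler0n.
have b5 : 4 ^+ L <= beta * 5 ^+ (L + p.+1).
  apply: le_trans (ler_wpM2l b0 bin5).
  by rewrite mulrA ler_peMl ?exprn_ge0.
have h1 : C * W <= 4 ^+ L * C' * W by rewrite ler_wpM2r.
apply: le_trans h1 _; apply: (@le_trans _ _ (beta * 5 ^+ (L + p.+1) * C' * W)).
  by rewrite !ler_wpM2r.
have -> : beta * 5 ^+ (L + p.+1) * C' * W = 2 * 5 ^+ (L + p.+1) * (2^-1 * C' * beta * W) by field.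
by rewrite ler_wpM2l ?mulr_ge0 ?exprn_ge0 // (le_trans tail).
Qed.

End Ratio.

(** * Choice of the parameters *)

From mathcomp Require Import all_classical all_reals all_analysis.
Import numFieldNormedType.Exports.
Local Open Scope classical_set_scope.
Local Open Scope ring_scope.

Lemma expR_ge_sqr (R : realType) (x : R) : 0 <= x -> (1 + x / 2) ^+ 2 <= expR x.
Proof.
move=> x0; have -> : expR x = expR (x / 2) ^+ 2.
  by rewrite -expRM_natl; congr expR; field.
by rewrite ler_pXn2r ?nnegrE ?expR_ge0 ?expR_ge1Dx //; lra.
Qed.

Lemma five_le_expR (R : realType) : 5 <= expR (9 / 5) :> R.
Proof.
(* 1.18 ^ 10 > 5 *)
have -> : expR (9 / 5) = expR (9 / 50 : R) ^+ 10 by rewrite -expRM_natl; congr expR; field.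
have h : (1 + 9 / 50 : R) <= expR (9 / 50) by rewrite expR_ge1Dx.
have h2 : (1 + 9 / 50 : R) ^+ 10 <= expR (9 / 50) ^+ 10.
  by rewrite ler_pXn2r ?nnegrE ?expR_ge0 //; lra.
by apply: le_trans h2; lra.
Qed.

Lemma ratio_pow_le (R : realType) (p t : nat) :
  2 * ln (p.+1%:R : R) + 2 <= t%:R ->
  (p%:R / p.+1%:R) ^+ (p.+1 * t) * (4 * p.+1%:R ^+ 2) <= 1 :> R.
Proof.
set s : R := p.+1%:R => ht; have s0 : 0 < s by apply: ltr0Sn.
have rho_le : p%:R / s <= expR (- s^-1).
  apply: le_trans (expR_ge1Dx _).
  have -> : 1 + - s^-1 = (s - 1) / s by rewrite mulrBl divff ?gt_eqF // mul1r.
  by rewrite /s -natr1 addrK.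
have : (p%:R / s) ^+ (p.+1 * t) <= expR (- t%:R).
  apply: (@le_trans _ _ (expR (- s^-1) ^+ (p.+1 * t))).
    by rewrite lerXn2r ?nnegrE ?expR_ge0 ?divr_ge0 // ltW.
  by rewrite -expRM_natl natrM -/s mulrN mulrAC divff ?gt_eqF // mul1r.
have : expR (- t%:R) <= expR (- (2 * ln s + 2)) by rewrite ler_expR; lra.
have -> : expR (- (2 * ln s + 2)) = (s ^+ 2)^-1 * expR (- 2).
  rewrite opprD expRD; congr (_ * _).
  by rewrite expRN expRM_natl lnK ?posrE.
move=> h1 h2; have h := le_trans h2 h1.
apply: le_trans (ler_wpM2r _ h) _; first by rewrite mulr_ge0 ?exprn_ge0 // ltW.
have -> : (s ^+ 2)^-1 * expR (- 2) * (4 * s ^+ 2) = 4 * expR (- 2).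
  by field; rewrite gt_eqF.
rewrite expRN ler_pdivrMr ?expR_gt0 // mul1r.
have := expR_ge_sqr (ler0n R 2); lra.
Qed.

Lemma ln_le_id (R : realType) (x : R) : 0 < x -> ln x <= x.
Proof.
move=> x0; rewrite -[leRHS]expRK ler_ln ?posrE ?expR_gt0 //.
by apply: le_trans (expR_ge1Dx _); lra.
Qed.

(** With [p] the first factor on the right, this is the condition under which
    [p / (p + 1)] bounds the ratios of numbers of compositions; the quotient
    [11 / 10] leaves room for replacing [n] by [n - L - 1]. *)
Lemma le_quota (n m L : nat) : (0 < n)%N -> (11 * L.+1 <= n)%N ->
  (m <= ((11 * m) %/ (10 * n)).+2 * (n - L).-1)%N.
Proof.
move=> n0 nL; have := ltn_ceil (11 * m) (_ : 0 < 10 * n)%N.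
rewrite muln_gt0 => /(_ n0); move: (_ %/ _)%N => q h.
have le10 : (10 * n <= 11 * (n - L).-1)%N by lia.
have : (q.+1 * (10 * n) <= q.+1 * (11 * (n - L).-1))%N by rewrite leq_mul2l le10 orbT.
by move: (n - L).-1 h => k; lia.
Qed.

(** The main term is at most [99 / 50 * mu * y], and for [y >= 990] the missing
    fiftieth of [mu * y] covers the terms linear in [mu]. *)
Lemma exponent_le (R : realFieldType) (mu y s l : R) :
  0 <= mu -> 990 <= y -> s <= 11 / 10 * mu + 3 -> 0 <= l -> l <= s -> 2 * l <= y ->
  9 / 5 * (s * (2 * l + 4)) <= 2 * mu * y + 54.
Proof.
move=> mu0 y990 s_le l0 ls ly.
have sl : s * l <= (11 / 10 * mu + 3) * l by rewrite ler_wpM2r.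
have mul : mu * (2 * l) <= mu * y by rewrite ler_wpM2l.
have muy : mu * 990 <= mu * y by rewrite ler_wpM2l.
lra.
Qed.

(** The scale [s] is [11/10 * m/n] up to a constant, and [L] is [s] times the least
    integer above [2 * ln s + 2], which makes [(1 - 1/s) ^+ L] at
    most [1 / (4 * s ^+ 2)]. *)
Lemma nb_diagrams_ge_exp (R : realType) (n m : nat) :
  (0 < n)%N -> 990 <= ln (n%:R : R) -> m%:R <= 2^-1 * n%:R `^ (3 / 2) :> R ->
  2^-1 * expR (- 54) * (expR (- 2 * (m%:R / n%:R) * ln n%:R)
     * (catalan n)%:R * (weak_compositions n m)%:R) <= (nb_diagrams n m)%:R :> R.
Proof.
move=> n0 hy hm; have n0R : 0 < n%:R :> R by rewrite ltr0n.
set y := ln _ in hy *; set mu := m%:R / n%:R.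
have nE : n%:R = expR y by rewrite /y lnK ?posrE.
(* E is the square root of n *)
set E := expR (y / 2).
have EE : expR y = E * E by rewrite -expRD; congr expR; field.
have mu0 : 0 <= mu by rewrite divr_ge0.
have muE : mu <= 2^-1 * E.
  rewrite ler_pdivrMr // -mulrA; apply: le_trans hm _.
  rewrite ler_wpM2l ?invr_ge0 // /powR gt_eqF // nE -expRD ler_expR expRK; lra.
have E_ge : (1 + y / 4) ^+ 2 <= E.
  have := @expR_ge_sqr R (y / 2) _; rewrite -/E => /(_ ltac:(lra)).
  by rewrite (_ : y / 2 / 2 = y / 4) //; field.
set q := ((11 * m) %/ (10 * n))%N; pose p := q.+2.
have q_le : q%:R <= 11 / 10 * mu :> R.
  rewrite (_ : 11 / 10 * mu = (11 * m)%N%:R / (10 * n)%N%:R).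
    by rewrite ler_pdivlMr ?ltr0n ?muln_gt0 // -natrM ler_nat leq_divM.
  by rewrite /mu !natrM; field; rewrite gt_eqF.
pose s : R := p.+1%:R.
have sq : s = q%:R + 3 by rewrite -natrD addn3.
have s_le : s <= 11 / 10 * mu + 3 by lra.
have s3 : 3 <= s by rewrite sq lerDr.
have s0 : 0 < s by lra.
have sE : s <= E by nra.
set l := ln s.
have l0 : 0 <= l by rewrite ln_ge0 //; lra.
have ls : l <= s by apply: ln_le_id.
have ly : 2 * l <= y.
  have : l <= y / 2 by rewrite -[leRHS]expRK ler_ln ?posrE ?expR_gt0.
  lra.
set t := (Num.truncn (2 * l + 2)).+1.
have t_gt : 2 * l + 2 <= t%:R by rewrite ltW // truncnS_gt.
have t_le : t%:R <= 2 * l + 3.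
  rewrite /t -natr1 (_ : 2 * l + 3 = 2 * l + 2 + 1) ?lerD2r; last by ring.
  by rewrite truncn_le //; lra.
set L := (p.+1 * t)%N.
have L_le : L%:R <= s * (2 * l + 3) by rewrite /L natrM ler_wpM2l // ltW.
have nL : (11 * L.+1 <= n)%N.
  rewrite -(ler_nat R) natrM -natr1 nE EE.
  have : L%:R <= E * (y + 3).
    by apply: le_trans L_le _; apply: ler_pM; lra.
  nra.
have mp : (m <= p * (n - L).-1)%N by exact: le_quota.
have Ln : (L < n)%N by apply: leq_trans nL; rewrite leq_pmull.
have := @nb_diagrams_lower R p L n m Ln mp (@ratio_pow_le R p t t_gt).
set X := _ * (weak_compositions n m)%:R; set T := (nb_diagrams n m)%:R.
move=> lower.
have pow5 : 5 ^+ (L + p.+1) <= expR (2 * mu * y + 54).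
  apply: (@le_trans _ _ (expR (9 / 5) ^+ (L + p.+1))).
    by rewrite ler_pXn2r ?nnegrE ?expR_ge0 ?five_le_expR.
  rewrite -expRM_natl ler_expR.
  apply: le_trans (exponent_le mu0 hy s_le l0 ls ly).
  rewrite [leLHS]mulrC ler_wpM2l // [(L + p.+1)%:R]natrD -/s.
  by rewrite (_ : s * (2 * l + 4) = s * (2 * l + 3) + s) ?lerD2r //; ring.
have T0 : 0 <= T by apply: ler0n.
have : X <= 2 * expR (2 * mu * y + 54) * T.
  by apply: le_trans lower _; rewrite ler_wpM2r // ler_wpM2l.
have eX : expR (- 2 * mu * y) * (catalan n)%:R * (weak_compositions n m)%:R
   = expR (- 2 * mu * y) * X by rewrite -[LHS]mulrA.
rewrite eX => h.
have -> : 2^-1 * expR (- 54) * (expR (- 2 * mu * y) * X) =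
   (2 * expR (2 * mu * y + 54))^-1 * X.
  have eE : (expR (2 * mu * y + 54))^-1 = expR (- 54) * expR (- 2 * mu * y).
    by rewrite -expRN -expRD; congr expR; ring.
  by rewrite invfM eE !mulrA.
by rewrite ler_pdivrMl ?mulr_gt0 ?expR_gt0.
Qed.

Theorem lemma3p2 (R : realType) :
  (forall n m : nat,
     (nb_diagrams n m <= catalan n * nb_perms n m)%N /\
     (catalan n * nb_perms n m <= catalan n * weak_compositions n m)%N) /\
  (forall m : nat -> nat,
     (fun n : nat => (m n)%:R : R) =o_\oo (fun n : nat => (n%:R : R) `^ (3 / 2)) ->
     exists c : R, 0 < c /\
       \forall n \near \oo,
         c * (expR (- 2 * ((m n)%:R / n%:R) * ln n%:R)
              * (catalan n)%:R * (weak_compositions n (m n))%:R)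
         <= (nb_diagrams n (m n))%:R).
Proof.
split=> [n m|m /eqoP small].
  by rewrite nb_diagrams_le leq_mul2l nb_perms_le orbT.
exists (2^-1 * expR (- 54)); split; first by rewrite mulr_gt0 ?invr_gt0 ?expR_gt0.
have half : 0 < 2^-1 :> R by rewrite invr_gt0.
near=> n; have n0 : (0 < n)%N by near: n; exact: nbhs_infty_gt.
apply: nb_diagrams_ge_exp => //.
- rewrite -[leLHS]expRK ler_ln ?posrE ?expR_gt0 ?ltr0n //.
  by near: n; exact: nbhs_infty_ger.
- have : `|(m n)%:R| <= 2^-1 * `|n%:R `^ (3 / 2)| :> R by near: n; exact: small.
  by rewrite !ger0_norm ?powR_ge0.
Unshelve. all: by end_near.
Qed.
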